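(* Let $(\Omega,\mathcal{F})$ be a measurable space, let $C$ be a nonempty closed convex bounded separable subset of a finite dimensional Banach space $X$, and let $T:\Omega\times C\to 2^{C}$ be a random operator which satisfies condition $\mathcal{M}$. Suppose that, for each $\omega\in\Omega$, $T(\omega,\cdot)$ is lower semicontinuous and 1-set-contractive, with nonempty, convex and closed values, and that the inverse $(T(\omega,\cdot))^{-1}$ on $C$ is closed valued, i.e. $\{x\in C: y\in T(\omega,x)\}$ is closed for every $y\in C$. Then $T$ has a random fixed point.
   Context: $2^{D}$ denotes the set of all nonempty subsets of $D$. For $F:C\to 2^{X}$ and $A\subseteq C$, $F(A)=\bigcup_{x\in A}F(x)$. Random operator: $T:\Omega\times C\to 2^{C}$ is a random operator if for each $x\in C$, $T(\cdot,x)$ is (lower) measurable, i.e. $\{\omega\in\Omega: T(\omega,x)\cap V\neq\emptyset\}\in\mathcal{F}$ for every $V$ open in $C$. Lower semicontinuous: $F:C\to 2^{C}$ is lower semicontinuous if for each $x\in C$ and each $V$ open in $C$ with $F(x)\cap V\neq\emptyset$ there is an open neighborhood $U$ of $x$ in $C$ with $F(y)\cap V\neq\emptyset$ for each $y\in U$. 1-set-contractive: $\gamma$ is the Kuratowski measure of noncompactness: for bounded $A\subseteq X$, $\gamma(A)=\inf\{e>0: A$ is covered by a finite number of sets of diameter $\le e\}$, and $\gamma(A)=\infty$ if $A$ is unbounded. $F:C\to 2^{X}$ is 1-set-contractive if $\gamma(F(A))\le\gamma(A)$ for each $A\subseteq C$ with $\gamma(A)>0$. Random fixed point of $T$: a measurable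 mapping $\xi:\Omega\to C$ with $\xi(\omega)\in T(\omega,\xi(\omega))$ for every $\omega\in\Omega$. Condition $\mathcal{M}$ for $T$: whenever $\eta_n,\xi_n:\Omega\to C$ ($n\in\mathbb{N}$) are measurable mappings with $\eta_n(\omega)\in T(\omega,\xi_n(\omega))$ for each $n$ and each $\omega\in\Omega$, and $\xi_n(\omega)-\eta_n(\omega)\to 0$ as $n\to\infty$ for each $\omega\in\Omega$, then there exists a random fixed point $\xi$ of $T$. *)

(* Defs.v *)
From HB Require Import structures.
From mathcomp Require Import all_boot all_order all_algebra.
From mathcomp Require Import all_classical all_reals all_analysis.
Set Implicit Arguments.
Unset Strict Implicit.
Unset Printing Implicit Defensive.
Import Order.TTheory GRing.Theory Num.Theory.
Import numFieldNormedType.Exports.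
Local Open Scope classical_set_scope.
Local Open Scope ring_scope.

(* A set-valued map [F : C -> 2^C] is represented by a total [F : X -> set X];
   only its values at points of [C] are ever constrained or used. *)

Definition finite_dimensional (R : realType) (X : normedModType R) : Prop :=
  exists (n : nat) (e : 'I_n -> X),
    forall x : X, exists c : 'I_n -> R, x = \sum_(i < n) c i *: e i.

Definition separable_set (X : topologicalType) (C : set X) : Prop :=
  exists D : set X, [/\ countable D, D `<=` C & C `<=` closure D].

Definition open_in (X : topologicalType) (C V : set X) : Prop :=
  exists2 U : set X, open U & V = C `&` U.

Section noncompactness.
Context (R : realType) (X : normedModType R).

(* The diameter of the empty set is [-oo] here; this is harmless since
   diameters are only compared with positive reals. *)
Definition diameter (A : set X) : \bar R :=
  ereal_sup [set z | exists x y : X, [/\ A x, A y & z = (`|x - y|)%:E]].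

Definition kuratowski (A : set X) : \bar R :=
  if `[< bounded_set A >] then
    ereal_inf [set e%:E | e in
      [set e : R | 0 < e /\
        exists (n : nat) (B : 'I_n -> set X),
          A `<=` \bigcup_i B i /\ forall i, (diameter (B i) <= e%:E)%E]]
  else +oo%E.

Definition one_set_contractive (C : set X) (F : X -> set X) : Prop :=
  forall A : set X, A `<=` C -> (0 < kuratowski A)%E ->
    (kuratowski (\bigcup_(x in A) F x) <= kuratowski A)%E.

End noncompactness.

Definition lower_semicontinuous_in (X : topologicalType) (C : set X)
    (F : X -> set X) : Prop :=
  forall (x : X) (V : set X), C x -> open_in C V -> F x `&` V !=set0 ->
    exists U : set X, [/\ open_in C U, U x &
      forall y : X, U y -> F y `&` V !=set0].

Section random_operators.
Context d (Omega : measurableType d) (R : realType) (X : normedModType R).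
Implicit Types (C : set X) (T : Omega -> X -> set X).

(* [X] carries its Borel sigma-algebra. *)
Definition measurable_map C (xi : Omega -> X) : Prop :=
  (forall w, C (xi w)) /\
  measurable_fun [set: Omega] (xi : Omega -> g_sigma_algebraType (@open X)).

Definition random_operator C T : Prop :=
  (forall w x, C x -> T w x !=set0 /\ T w x `<=` C) /\
  (forall x, C x -> forall V : set X, open_in C V ->
    measurable [set w | T w x `&` V !=set0]).

Definition random_fixed_point C T (xi : Omega -> X) : Prop :=
  measurable_map C xi /\ forall w, T w (xi w) (xi w).

Definition condition_M C T : Prop :=
  forall eta xi : nat -> Omega -> X,
    (forall n, measurable_map C (eta n)) ->
    (forall n, measurable_map C (xi n)) ->
    (forall n w, T w (xi n w) (eta n w)) ->
    (forall w, (fun n => xi n w - eta n w) @ \oo --> (0 : X)) ->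
    exists xi0 : Omega -> X, random_fixed_point C T xi0.

End random_operators.

(* Main.v *)
Require Import Defs.
From mathcomp Require Import all_boot all_order all_algebra finmap zify lra ring.
Set Implicit Arguments.
Unset Strict Implicit.
Unset Printing Implicit Defensive.

(** A lower semicontinuous convex-valued map on a compact convex set has, for
    every r > 0, a point within distance r of its image: a partition of unity
    turns this into a Brouwer-type statement, obtained here (approximately, on a
    grid of the simplex) from Scarf's combinatorial lemma. By lower
    semicontinuity the points with this property form an open set, so they
    include points of a fixed dense sequence, and taking the first such index
    depends measurably on the parameter. A Kuratowski--Ryll-Nardzewski selection
    started at these points gives measurable xi_n and eta_n in T(., xi_n) at
    distance O(1/n), and condition M concludes. *)

(** * Scarf's lemma *)

Section Scarf.
Variables (I E : finType) (r : I -> E -> nat) (c : E -> I) (i0 : I).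
Hypothesis r_inj : forall i, injective (r i).
Implicit Type S : {set E}.

(** These are Scarf's primitive sets: no [y] exceeds the minimum of [S] in every order. Taking [y]
    in [S] shows that each element of [S] is its minimum in some order, so [S] has at most [#|I|]
    elements. *)
Definition dominant S := [forall y, exists i, forall s in S, r i y <= r i s].

Lemma dominantP S :
  reflect (forall y, exists i, forall s, s \in S -> r i y <= r i s) (dominant S).
Proof.
apply: (iffP forallP) => h y; move: (h y).
  by move/existsP => [i /forall_inP]; exists i.
by move=> [i ?]; apply/existsP; exists i; apply/forall_inP.
Qed.

Lemma dominantS S S' : S \subset S' -> dominant S' -> dominant S.
Proof.
move=> /subsetP sub /dominantP dS; apply/dominantP => y.
by have [i hi] := dS y; exists i => s /sub; apply: hi.
Qed.

(** The count is 0 or 2. If [S :\ x] carries each colour but [i0] once, then [c x] is not [i0],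
    since some colour is missing from [S]. So [x] shares its colour with exactly one [x'], and only
    removing [x] or [x'] leaves a good facet. *)
Lemma even_good_facets S : #|S| = #|I| -> c @: S != [set: I] ->
  ~~ odd #|[set x in S | c @: (S :\ x) == ~: [set i0]]|.
Proof.
move=> cS ncol.
have [->|[x]] := set_0Vmem [set x in S | c @: (S :\ x) == ~: [set i0]].
  by rewrite cards0.
rewrite inE => /andP[xS /eqP cx].
have cSx : #|S :\ x| = #|I|.-1 by rewrite -cS (cardsD1 x S) xS.
have inj : {in S :\ x &, injective c}.
  by apply/imset_injP; rewrite cx cardsC1 cSx.
have cxE : c x != i0.
  apply: contraNneq ncol => cxi; apply/eqP/setP => i; rewrite inE.
  have [->|ni] := eqVneq i i0; first by rewrite -cxi imset_f.
  have : i \in ~: [set i0] by rewrite !inE.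
  by rewrite -cx => /imsetP[z /setD1P[_ zS] ->]; rewrite imset_f.
have : c x \in c @: (S :\ x) by rewrite cx !inE.
case/imsetP => x' x'Sx cxx'; have /setD1P[x'x x'S] := x'Sx.
suff -> : [set z in S | c @: (S :\ z) == ~: [set i0]] = [set x; x'].
  by rewrite cards2 eq_sym x'x.
apply/setP => z; rewrite !inE; apply/andP/orP; last first.
  case=> /eqP->; split => //; first exact/eqP.
  rewrite -cx; apply/eqP/setP => i; apply/imsetP/imsetP => -[w /setD1P[wx wS] ->].
    by have [->|wnx] := eqVneq w x; [exists x' | exists w; rewrite // !inE wnx].
  have [->|wnx] := eqVneq w x'; last by exists w; rewrite // !inE wnx.
  by exists x; rewrite // !inE eq_sym x'x.
case=> zS /eqP cz.
have [|zx] := eqVneq z x; first by left.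
have [|zx'] := eqVneq z x'; first by right.
have zSx : z \in S :\ x by rewrite !inE zx.
have : c z \in c @: (S :\ z) by rewrite cz -cx imset_f.
case/imsetP => w /setD1P[wz wS] czw.
have [wx|wx] := eqVneq w x.
  have := inj z x' zSx x'Sx; rewrite -cxx' czw wx => /(_ erefl) zx''.
  by rewrite zx'' eqxx in zx'.
have := inj z w zSx; rewrite !inE wx wS => /(_ isT czw) zw.
by rewrite zw eqxx in wz.
Qed.

(** The minima [m i] exhaust [S], which has one element fewer than there are orders, so exactly one
    pair [a], [b] shares its minimum. A point completing [S] must become the minimum in order [a] or
    in order [b], and each of the two admits at most one such point. *)
Lemma cofacet_count S : S != set0 -> #|S|.+1 = #|I| -> dominant S ->
  exists (m : I -> E) (a b : I), [/\ a != b, m a = m b,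
    forall i, m i \in S /\ (forall s, s \in S -> r i (m i) <= r i s) &
    #|[set y | (y \notin S) && dominant (y |: S)]| =
      [exists y, [forall i, (i != a) ==> (r i (m i) < r i y)]]
    + [exists y, [forall i, (i != b) ==> (r i (m i) < r i y)]]].
Proof.
move=> /set0Pn[s0 s0S] cS /dominantP dS.
pose m i := [arg min_(s < s0 in S) r i s].
have mP i : m i \in S /\ (forall s, s \in S -> r i (m i) <= r i s).
  by rewrite /m; case: arg_minnP.
have mS y : y \in S -> exists i, y = m i.
  move=> yS; have [i hi] := dS y; exists i; apply: (r_inj (i := i)); apply/eqP.
  by rewrite eqn_leq hi ?(mP i).2 ?(mP i).1.
have imE : m @: [set: I] = S.
  apply/setP => y; apply/imsetP/idP => [[i _ ->]|/mS[i ->]]; last by exists i.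
  exact: (mP i).1.
have /existsP[a /existsP[b /andP[ab /eqP mab]]] :
    [exists a, exists b, (a != b) && (m a == m b)].
  apply: contraT => /existsPn h.
  have : #|m @: [set: I]| = #|[set: I]|.
    apply: card_in_imset => a b _ _ mab; apply/eqP.
    by move: (h a) => /existsPn/(_ b); rewrite mab eqxx andbT negbK.
  by rewrite imE cardsT -cS => /eqP; rewrite -[#|S|]addn0 -addnS eqn_add2l.
have injm k : k \in [set a; b] -> {in ~: [set k] &, injective m}.
  move=> kab; apply/imset_injP; rewrite cardsC1 -cS /=.
  apply/eqP; apply: eq_card => y; apply/imsetP/idP.
    by move=> [i _ ->]; exact: (mP i).1.
  move=> /mS[i ->]; have [->|ik] := eqVneq i k; last by exists i; rewrite ?inE.
  move: kab; rewrite !inE => /orP[] /eqP ->.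
    by exists b; rewrite // !inE eq_sym.
  by exists a; rewrite // !inE.
exists m, a, b; split => //.
(* [M k y] says that [y] leaves the minima of the orders other than [k] in place. Among these
   candidates only the [r k]-largest, collected in [top k], keeps the enlarged set dominant. *)
pose M k y := [forall i, (i != k) ==> (r i (m i) < r i y)].
pose top k := [set y | M k y && [forall z, M k z ==> (r k z <= r k y)]].
have MP k y : reflect (forall i, i != k -> r i (m i) < r i y) (M k y).
  by apply: (iffP forall_inP).
have topP k y : reflect (M k y /\ forall z, M k z -> r k z <= r k y) (y \in top k).
  rewrite inE; apply: (iffP andP) => -[? h]; split => //.
    by move=> z; apply: (forall_inP h).
  exact/forall_inP.
have ctop k : #|top k| = [exists y, M k y].
  case: (boolP [exists y, M k y]) => [/existsP[y My]|/existsPn nM].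
    apply/eqP/cards1P; exists [arg max_(z > y | M k z) r k z]; apply/setP => z.
    case: arg_maxnP => //= t Mt tmax; rewrite inE.
    apply/topP/eqP => [[Mz zmax]|->]; last by split.
    by apply: (r_inj (i := k)); apply/eqP; rewrite eqn_leq tmax ?zmax.
  by apply: eq_card0 => y; apply/topP => -[My _]; move: (nM y); rewrite My.
have dis : [disjoint top a & top b].
  apply/pred0P => y /=; apply/negbTE/negP => /andP[/topP[/MP Ma _] /topP[/MP Mb _]].
  have [i hi] := dS y; have : r i (m i) < r i y.
    by have [ia|/Ma//] := eqVneq i a; apply: Mb; rewrite ia.
  by rewrite ltnNge hi // (mP i).1.
have key k y : k \in [set a; b] -> y \in top k -> y \notin S /\ dominant (y |: S).
  move=> kab /topP[/MP My ymax].
  have [k' k'k mk'k] : exists2 k', k' != k & m k' = m k.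
    by move: kab; rewrite !inE => /orP[] /eqP->; [exists b; rewrite 1?eq_sym | exists a].
  have yS : y \notin S.
    apply/negP => /mS[i yi].
    have [j jk yj] : exists2 j, j != k & y = m j.
      by have [ik|ik] := eqVneq i k; [exists k'; rewrite // mk'k -ik | exists i].
    by have := My j jk; rewrite -yj ltnn.
  split => //; apply/dominantP => z.
  (* A candidate [z] is bounded in order [k], where [y] is maximal among candidates and lies below
     [S]. Any other [z] is bounded in an order [i != k] by the minimum [m i], which is below [y]. *)
  case: (boolP (M k z)) => [Mz|].
    exists k => s /setU1P[->|sS]; first exact: ymax.
    apply: leq_trans (ymax _ Mz) _; have [i hi] := dS y.
    have [ik|ik] := eqVneq i k; first by rewrite -ik hi.
    by have := My i ik; rewrite ltnNge hi // (mP i).1.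
  move/forall_inPn => [i ik]; rewrite -leqNgt => zi.
  exists i => s /setU1P[->|sS]; first by apply: leq_trans zi (ltnW (My i ik)).
  exact: leq_trans zi ((mP i).2 _ sS).
rewrite -!ctop -cardsUI.
rewrite (_ : top a :&: top b = set0) ?cards0 ?addn0; last first.
  by apply/eqP; rewrite setI_eq0.
apply: eq_card => y; rewrite [LHS]inE [RHS]inE; apply/andP/orP; last first.
  by case; apply: key => //; rewrite !inE eqxx ?orbT.
case=> yS /dominantP dyS.
(* In order [i] the new point is the minimum of [y |: S], so the orders other than [i] must already
   supply all of [S]. This forces [i] to be [a] or [b]. *)
have [i hi] := dyS y.
have cover s : s \in S -> exists2 j, j != i & s = m j /\ r j s <= r j y.
  move=> sS; have [j hj] := dyS s; exists j.
    apply: contraNneq yS => ji; rewrite (_ : y = s) //; apply: (r_inj (i := i)).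
    by apply/eqP; rewrite eqn_leq hi ?setU1r // -ji hj ?setU11.
  split; last by rewrite hj ?setU11.
  by apply: (r_inj (i := j)); apply/eqP; rewrite eqn_leq hj ?setU1r ?(mP j).1 ?(mP j).2.
have iab : i \in [set a; b].
  apply: contraT => /[!inE] /norP[ia ib].
  have [j ji [mij _]] := cover _ (mP i).1.
  have [ja|ja] := eqVneq j a.
    have := injm b _ i j; rewrite !inE eqxx orbT ib ja ab -ja => /(_ isT isT isT mij) ij.
    by rewrite ij eqxx in ji.
  have := injm a _ i j; rewrite !inE eqxx ia ja => /(_ isT isT isT mij) ij.
  by rewrite ij eqxx in ji.
suff : y \in top i by move: iab; rewrite !inE => /orP[] /eqP->; [left|right].
have My : M i y.
  apply/MP => j ji; have [j' j'i [mjj' le]] := cover _ (mP j).1.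
  have := injm i iab j j'; rewrite !inE ji j'i => /(_ isT isT mjj') jj'.
  rewrite -jj' in le; rewrite ltn_neqAle le andbT.
  apply: contraNneq yS => /r_inj <-; exact: (mP j).1.
apply/topP; split => // z /MP Mz; have [j hj] := dyS z.
have [<-|ji] := eqVneq j i; first by rewrite hj ?setU11.
by have := Mz j ji; rewrite ltnNge hj // setU1r // (mP j).1.
Qed.

(** Both sides count pairs of a room and a good facet of it. For a fixed removed point [x], the maps
    [S :\ x] and [x |: D] are inverse to each other. *)
Lemma facet_double_count (room : pred {set E}) (good : pred {set E}) :
  \sum_(S | room S) #|[set x in S | good (S :\ x)]| =
  \sum_(D | good D) #|[set y | (y \notin D) && room (y |: D)]|.
Proof.
under eq_bigr do rewrite -sum1_card.
under [RHS]eq_bigr do rewrite -sum1_card.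
rewrite (exchange_big_dep xpredT) //= [RHS](exchange_big_dep xpredT) //=.
apply: eq_bigr => x _.
rewrite (reindex_onto (fun D => x |: D) (fun S => S :\ x)) /=; last first.
  by move=> S; rewrite inE => /andP[_ /andP[xS _]]; rewrite setD1K.
apply: eq_bigl => D; rewrite !inE eqxx /=.
have [xD|xD] := boolP (x \in D).
  rewrite andbF; apply/negbTE; rewrite !negb_and; apply/orP; right.
  by apply/eqP => eqD; move: xD; rewrite -eqD !inE eqxx.
by rewrite setU1K // eqxx andbT andbC.
Qed.

End Scarf.

Lemma scarf (I T : finType) (r : I -> T -> nat) (c : T -> I) (x0 : T) :
  (forall i, injective (r i)) -> 1 < #|I| ->
  exists (A : {set T}) (J : {set I}),
    (forall y, exists2 i, i \in J & forall x, x \in A -> r i y <= r i x) /\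
    (forall i, i \in J -> exists2 x, x \in A & c x = i).
Proof.
move=> r_inj I_gt1.
(* One slack element per order is adjoined to [T], least in its own order and
   above [T] in the others. Scarf's parity argument counts the facets [S :\ x]
   of dominant [#|I|]-sets [S] whose colours are all but [i0]: every such facet
   lies in two dominant sets, except the one made of slacks only. *)
pose N := (\max_i \max_x r i x).+2.
have rN i x : (r i x).+1 < N.
  by rewrite 2!ltnS (bigD1 i) //= leq_max (bigD1 x) //= leq_max leqnn.
pose r' i (e : T + I) := match e with
  | inl x => (r i x).+1
  | inr j => if i == j then 0 else N + enum_rank j end.
pose c' (e : T + I) := match e with inl x => c x | inr j => j end.
have r'_inj i : injective (r' i).
  move=> [x|j] [y|k] /=; first by move=> [/r_inj->].
  - by case: eqP => // _; have := rN i x; lia.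
  - by case: eqP => // _; have := rN i y; lia.
  - case: (eqVneq i j) => [<-|_]; case: (eqVneq i k) => [<-|_] //.
    by move=> /eqP; rewrite eqn_add2l => /eqP/val_inj/enum_rank_inj->.
have /card_gt0P[i0 _] : 0 < #|I| by lia.
pose room (S : {set T + I}) := (#|S| == #|I|) && dominant r' S.
have [S /= /and3P[_ /dominantP dS /eqP colS]|none] :=
    pickP [pred S : {set T + I} | [&& #|S| == #|I|, dominant r' S & c' @: S == [set: I]]].
  (* The slacks are discarded. An order whose slack lies in [S] bounds no point of [T], its slack
     having rank [0]; an order whose slack is absent must get its colour from a point of [T]. *)
  exists [set x | inl x \in S], [set i | inr i \notin S]; split.
    move=> y; have [i hi] := dS (inl y); exists i.
      by rewrite inE; apply/negP => /hi /=; rewrite eqxx.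
    by move=> x; rewrite inE => /hi.
  move=> i; rewrite inE => iS.
  have : i \in c' @: S by rewrite colS.
  case/imsetP => -[x|j] sS /= ij; first by exists x; rewrite ?inE.
  by rewrite ij sS in iS.
pose good (D : {set T + I}) := c' @: D == ~: [set i0].
have := facet_double_count room good.
pose D0 : {set T + I} := [set inr j | j in ~: [set i0]].
have gD0 : good D0.
  rewrite /good /D0 -imset_comp; apply/eqP/setP => j; apply/imsetP/idP => [[k kI ->]//|jI].
  by exists j.
have cD0 : #|D0|.+1 = #|I|.
  by rewrite card_imset ?cardsC1; [lia | move=> ? ? []].
have dD0 : dominant r' D0.
  apply/dominantP => -[x|j]; last by exists j => s _; rewrite /= eqxx.
  exists i0 => s /imsetP[j]; rewrite !inE => ji -> /=; rewrite eq_sym (negbTE ji).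
  by have := rN i0 x; lia.
have out D : good D -> D != D0 ->
    ~~ odd #|[set y | (y \notin D) && room (y |: D)]|.
  move=> gD DD0.
  have [[y]|emp] := set_0Vmem [set y | (y \notin D) && room (y |: D)].
    by move/eqP: y; rewrite -cards_eq0 => /eqP->.
  case: emp => y; rewrite inE => /and3P[yD /eqP cyD dyD].
  have cD : #|D|.+1 = #|I| by rewrite -cyD cardsU1 yD.
  have dD : dominant r' D by apply: dominantS dyD; apply: subsetU1.
  have D0' : D != set0 by rewrite -card_gt0; lia.
  have [m [a [b [ab mab mP cnt]]]] := cofacet_count r'_inj D0' cD dD.
  rewrite (_ : [set _ | _] = [set y0 | (y0 \notin D) && dominant r' (y0 |: D)]); last first.
    apply/setP => z; rewrite !inE; case: (boolP (z \in D)) => //= zD.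
    by rewrite /room cardsU1 zD /= add1n cD eqxx.
  (* A good facet made of slacks only is contained in [D0], hence equal to it by cardinality. *)
  have [x xD] : exists x, inl x \in D.
    have : ~~ (D \subset D0).
      apply: contra DD0 => sub; by rewrite eqEcard sub -ltnS cD0 -cD /=.
    case/subsetPn => -[x|j] xD; first by exists x.
    case/negP; apply/imset_f.
    by move/eqP: gD => <-; apply/imsetP; exists (inr j).
  (* Every minimum is at most the rank of [inl x], thus below [N], whereas [inr k] has rank at least
     [N] in all orders but [k]. Both cofacets therefore exist. *)
  have Mk k : [exists y0, [forall i, (i != k) ==> (r' i (m i) < r' i y0)]].
    apply/existsP; exists (inr k); apply/forall_inP => i ik /=.
    rewrite (negbTE ik); apply: leq_ltn_trans ((mP i).2 _ xD) _.
    exact: leq_trans (rN i x) (leq_addr _ _).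
  by rewrite cnt !Mk.
(* The shared minimum of [D0] belongs to [i0] and some [k]. For [i0] any point of [T] is a
   candidate, the other minima having rank [0]. For [k] there is none: points of [T] and [inr k]
   itself are not above [inr k] in order [i0], and [inr j] with [j != k] has rank [0] in order
   [j]. *)
have odd0 : odd #|[set y | (y \notin D0) && room (y |: D0)]|.
  have D0' : D0 != set0 by rewrite -card_gt0; lia.
  have [m [a [b [ab mab mP cnt]]]] := cofacet_count r'_inj D0' cD0 dD0.
  rewrite (_ : [set _ | _] = [set y0 | (y0 \notin D0) && dominant r' (y0 |: D0)]); last first.
    apply/setP => z; rewrite !inE; case: (boolP (z \in D0)) => //= zD.
    by rewrite /room cardsU1 zD /= add1n cD0 eqxx.
  have inD0 j : j != i0 -> inr j \in D0.
    by move=> ji; apply: imset_f; rewrite !inE.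
  have mE j : j != i0 -> m j = inr j.
    move=> ji; apply: (r'_inj j); have := (mP j).2 _ (inD0 _ ji).
    by rewrite /= eqxx leqn0 => /eqP.
  have top1 k : k = i0 -> [exists y0, [forall i, (i != k) ==> (r' i (m i) < r' i y0)]].
    move=> ->; apply/existsP; exists (inl x0); apply/forall_inP => j ji.
    by rewrite mE //= eqxx.
  have top0 k : k != i0 -> m k = m i0 ->
      ~~ [exists y0, [forall i, (i != k) ==> (r' i (m i) < r' i y0)]].
    move=> ki mk; have ik : i0 != k by rewrite eq_sym.
    apply/existsPn => -[x|j]; apply/forall_inPn.
      exists i0; first exact: ik.
      rewrite -mk mE // /r' (negbTE ik) -leqNgt.
      exact: leq_trans (ltnW (rN i0 x)) (leq_addr _ _).
    have [->|jk] := eqVneq j k.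
      by exists i0; [exact: ik | rewrite -mk mE // ltnn].
    by exists j => //=; rewrite eqxx.
  rewrite cnt oddD.
  have [ai|ai] := eqVneq a i0.
    rewrite (top1 a ai) (negbTE (top0 b _ _)) //; first by rewrite -ai eq_sym.
    by rewrite -mab ai.
  have bi : b = i0.
    apply/eqP; apply: contraT => bi; move: mab; rewrite !mE // => -[abE].
    by rewrite abE eqxx in ab.
  by rewrite (top1 b bi) (negbTE (top0 a _ _)) // mab bi.
move=> /(congr1 odd).
rewrite [X in _ = odd X](bigD1 D0) //= oddD odd0.
rewrite !(big_morph odd oddD (erefl _)) !big1 //.
  by move=> D /andP[gD nD]; apply/negbTE; apply: out.
move=> S rS; apply/negbTE; apply: even_good_facets; first by case/andP: rS => /eqP.
by have := none S; case/andP: rS => /= -> -> /= ->.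
Qed.

(** * Scarf's lemma on the integer grid of a simplex *)

Lemma simplex_grid_dominating (I : finType) (N : nat) (J : {set I}) (f : I -> nat) (j : I) :
  j \in J -> \sum_(i in J) f i <= N ->
  exists2 t : {ffun I -> 'I_N.+1}, \sum_i (t i : nat) = N &
    forall i, i \in J -> f i <= t i.
Proof.
move=> jJ sumf.
pose g i := (i \in J) * f i + (i == j) * (N - \sum_(i in J) f i).
have sumg : \sum_i g i = N.
  rewrite big_split /= -[X in _ = X](subnKC sumf); congr (_ + _).
    by rewrite [RHS]big_mkcond; apply: eq_bigr => i _; case: (i \in J); rewrite ?mul1n.
  rewrite -big_distrl /= (bigD1 j) //= eqxx big1 ?addn0 ?mul1n //.
  by move=> i /negbTE->.
have gN i : g i < N.+1 by rewrite ltnS -sumg (bigD1 i) //= leq_addr.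
exists [ffun i => Ordinal (gN i)].
  by rewrite -[RHS]sumg; apply: eq_bigr => i _; rewrite ffunE.
by move=> i iJ; rewrite ffunE /= /g iJ mul1n leq_addr.
Qed.

(** Scarf's lemma is applied to the grid points ordered by each coordinate. Dominance makes the
    coordinatewise minima over [A] sum almost to [N], so the points of [A] are mutually close and
    nearly vanish off [J], while [A] shows every colour of [J]. *)
Lemma grid_sperner (I : finType) (N : nat) (c : {ffun I -> 'I_N.+1} -> I) :
  1 < #|I| ->
  exists2 x0 : {ffun I -> 'I_N.+1}, \sum_i (x0 i : nat) = N &
    forall i, x0 i <= #|I| \/ exists x : {ffun I -> 'I_N.+1},
      [/\ \sum_k (x k : nat) = N, c x = i &
        forall k, x k <= x0 k + #|I| /\ x0 k <= x k + #|I|].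
Proof.
move=> I_gt1.
pose T := {t : {ffun I -> 'I_N.+1} | \sum_i (t i : nat) == N}.
have /card_gt0P[j0 _] : 0 < #|I| by lia.
have [t0 /eqP t0N _] : exists2 t : {ffun I -> 'I_N.+1}, \sum_i (t i : nat) = N &
    forall i, i \in [set j0] -> 0 <= t i.
  by apply: (simplex_grid_dominating (f := fun=> 0) (set11 j0)); rewrite big1.
have tN (t : T) : \sum_i (val t i : nat) = N by apply/eqP; case: t.
(* The coordinate decides, and the enumeration rank, smaller than the factor [#|{: T}|], breaks
   ties. *)
pose r (i : I) (t : T) := val t i * #|{: T}| + enum_rank t.
have r_le i t t' : r i t <= r i t' -> val t i <= val t' i.
  rewrite /r => le; rewrite leqNgt; apply/negP => lt.
  have : (val t' i).+1 * #|{: T}| <= val t i * #|{: T}| by rewrite leq_mul2r lt orbT.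
  move=> /leq_trans/(_ (leq_addr (enum_rank t) _))/leq_trans/(_ le).
  by rewrite mulSn addnC leq_add2l leqNgt ltn_ord.
have r_inj i : injective (r i).
  move=> t t' e; have le := r_le i t t'; have le' := r_le i t' t.
  rewrite e leqnn in le le'.
  have {le le'} tt' : val t i = val t' i :> nat by have := le isT; have := le' isT; lia.
  move: e; rewrite /r tt' => /eqP; rewrite eqn_add2l => /eqP/val_inj.
  exact: enum_rank_inj.
have [A [J [dom col]]] := scarf (c \o val) (Sub t0 t0N : T) r_inj I_gt1.
have [j1 j1J _] := dom (Sub t0 t0N).
have [x1 x1A _] := col _ j1J.
pose mu i := val [arg min_(t < x1 in A) (val t i : nat)] i : nat.
have muP i t : t \in A -> mu i <= val t i.
  by rewrite /mu; case: arg_minnP => // s sA smin /smin.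
have muA i : exists2 t, t \in A & mu i = val t i.
  by rewrite /mu; case: arg_minnP => // s sA _; exists s.
(* Otherwise some grid point would exceed the minimum [mu i] for all [i] in [J], against
   dominance. *)
have summu : N < \sum_(i in J) (mu i).+1.
  rewrite ltnNge; apply/negP => /(simplex_grid_dominating j1J)[y /eqP yN yJ].
  have [i iJ hi] := dom (Sub y yN); have [t tA mut] := muA i.
  by have := r_le _ _ _ (hi t tA); rewrite SubK -mut leqNgt yJ.
(* The other coordinates of [t] are at least their minima, and the total is [N], so little mass is
   left for [t i] beyond [mu i], or beyond [0] off [J]. *)
have close t i : t \in A -> val t i <= (i \in J) * mu i + #|I|.
  move=> tA.
  have eN : val t i + \sum_(k | k != i) (val t k : nat) = N.
    by rewrite -[RHS](tN t) [RHS](bigD1 i).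
  have : N < (i \in J) * (mu i).+1 + \sum_(k | k != i) (val t k).+1.
    apply: leq_trans summu _; rewrite big_mkcond (bigD1 i) //=.
    apply: leq_add; first by case: (i \in J); rewrite ?mul1n.
    by apply: leq_sum => k _; case: (k \in J); rewrite // ltnS muP.
  have -> : \sum_(k | k != i) (val t k).+1 = \sum_(k | k != i) val t k + #|I|.-1.
    rewrite (eq_bigr (fun k => val t k + 1)) => [|k _]; last by rewrite addn1.
    rewrite big_split /= sum_nat_const muln1; congr (_ + _).
    by rewrite -(cardC1 i); apply: eq_card => k; rewrite !inE.
  move: eN; move: (val t i : nat) (\sum_(k | k != i) _) => ti s.
  by case: (i \in J); lia.
exists (val x1); first exact: tN.
move=> i; have [iJ|iJ] := boolP (i \in J); last first.
  by left; have := close x1 i x1A; rewrite (negbTE iJ).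
have [x xA cx] := col i iJ; right; exists (val x); split=> //.
move=> k; have := close x1 k x1A; have := close x k xA.
have := muP k x1 x1A; have := muP k x xA; by case: (k \in J); lia.
Qed.

From mathcomp Require Import all_classical all_reals all_analysis.
Import Order.TTheory GRing.Theory Num.Theory.
Import numFieldNormedType.Exports.
Local Open Scope classical_set_scope.
Local Open Scope ring_scope.

(** * Approximate fixed points *)

(** The point sought is nearly fixed by the normalised combination of the [y i] with weights
    [phi i]. A grid point gets a colour [i] with [S * lam i <= phi i]. The grid lemma yields one
    point where all these inequalities nearly hold; since the differences sum to zero, they are all
    small. *)
Lemma approximate_brouwer (R : realType) (X : normedModType R) (I : finType)
    (y : I -> X) (phi : I -> X -> R) (e : R) :
  (0 < #|I|)%N -> 0 < e ->
  (forall i x, 0 <= phi i x <= 1) ->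
  (forall i x x', `|phi i x - phi i x'| <= `|x - x'|) ->
  exists2 lam : I -> R, (forall i, 0 <= lam i) /\ \sum_i lam i = 1 &
    `|\sum_i phi i (\sum_j lam j *: y j) *: (y i - \sum_j lam j *: y j)| <= e.
Proof.
move=> I_gt0 e0 phi01 phi_lip.
have [I_gt1|I_le1] := ltnP 1 #|I|; last first.
  have I1 : #|I| = 1%N by apply/eqP; rewrite eqn_leq I_le1.
  have [i0 Ii0] := fintype1P (introT eqP I1); exists (fun=> 1).
    by split=> //; rewrite sumr_const I1.
  rewrite (_ : \sum_i _ = 0) ?normr0 ?ltW //; apply: big1 => i _.
  rewrite (bigD1 i) //= big1 ?addr0 ?scale1r ?subrr ?scaler0 // => j.
  by rewrite (Ii0 j) (Ii0 i) eqxx.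
pose K : R := #|I|%:R; pose B := \sum_i `|y i|.
have K1 : 1 <= K by rewrite ler1n.
have B0 : 0 <= B by apply: sumr_ge0.
(* [D / N] collects the errors of moving to a neighbouring grid point: [K * (K / N)] from [lam],
   [K * (K / N * B)] from [S], and [K / N * B] from [phi i]. Then [N] is chosen to make
   [K * (D / N) * B] at most [e]. *)
pose D := K * K + (1 + K) * K * B.
have D0 : 0 <= D.
  by rewrite addr_ge0 // ?mulr_ge0 // ?addr_ge0 //; lra.
have A0 : 0 <= K * D * B / e by rewrite !mulr_ge0 // ?invr_ge0 ?ltW //; lra.
have [N N0 AN] : exists2 N, (0 < N)%N & K * D * B / e <= N%:R.
  have := archi_boundP A0; case: (Num.bound _) => [|N] lt.
    by move: (le_lt_trans A0 lt); rewrite ltxx.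
  by exists N.+1 => //; exact: ltW.
have N0R : 0 < N%:R :> R by rewrite ltr0n.
pose lam (x : {ffun I -> 'I_N.+1}) i : R := (x i)%:R / N%:R.
have lam0 x i : 0 <= lam x i by rewrite divr_ge0.
pose p x := \sum_j lam x j *: y j.
pose S z := \sum_i phi i z.
have S0 z : 0 <= S z by apply: sumr_ge0 => i _; case/andP: (phi01 i z).
have SK z : S z <= K.
  rewrite /K -sumr_const; apply: ler_sum => i _; by case/andP: (phi01 i z).
have Slip z z' : S z <= S z' + K * `|z - z'|.
  rewrite -lerBlDl -sumrB; apply: le_trans (ler_norm _) _.
  apply: le_trans (ler_norm_sum _ _ _) _.
  rewrite /K mulr_natl -sumr_const; exact: ler_sum.
have sumlam (x : {ffun I -> 'I_N.+1}) :
    (\sum_i (x i : nat) = N)%N -> \sum_i lam x i = 1.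
  by move=> xN; rewrite -mulr_suml -natr_sum xN divff ?lt0r_neq0.
(* If every inequality failed, summing over [i] would give [S < S], as the [lam x i] sum to [1]. *)
have /choice[c cP] (x : {ffun I -> 'I_N.+1}) : exists i,
    (\sum_i (x i : nat) = N)%N -> S (p x) * lam x i <= phi i (p x).
  have [xN|xN] := eqVneq (\sum_i (x i : nat))%N N; last first.
    have /card_gt0P[i _] := I_gt0; exists i => xN'; by rewrite xN' eqxx in xN.
  apply: contrapT => /forallNP h.
  have : \sum_i phi i (p x) < \sum_i S (p x) * lam x i.
    have /card_gt0P[i0 _] := I_gt0.
    apply: ltr_sum; first by apply/hasP; exists i0; rewrite ?mem_index_enum.
    by move=> i _; rewrite ltNge; apply/negP => hi; apply: (h i).
  by rewrite -mulr_sumr sumlam // mulr1 ltxx.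
have [x0 x0N x0P] := grid_sperner c I_gt1.
exists (lam x0); first by split => //; exact: sumlam.
rewrite -/(p x0); set p0 := p x0.
have lam_close (x : {ffun I -> 'I_N.+1}) i : (x i <= x0 i + #|I|)%N -> (x0 i <= x i + #|I|)%N ->
    `|lam x i - lam x0 i| <= K / N%:R.
  move=> h1 h2; rewrite /lam -mulrBl normrM normfV (ger0_norm (ltW N0R)).
  rewrite ler_pM2r ?invr_gt0 // ler_distl lerBlDr /K -!natrD !ler_nat.
  by rewrite h1 h2.
(* Either the coordinate [i] of [x0] is itself at most [K / N], or the inequality is transported
   from a nearby point of colour [i]. *)
have dP i : - (D / N%:R) <= phi i p0 - S p0 * lam x0 i.
  suff : S p0 * lam x0 i <= phi i p0 + D / N%:R by lra.
  have DN : D / N%:R = K * (K / N%:R) + (1 + K) * (K / N%:R * B).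
    by rewrite /D; ring.
  have KN0 : 0 <= K / N%:R by rewrite divr_ge0 //; lra.
  have KNB0 : 0 <= K / N%:R * B by rewrite mulr_ge0.
  have [small|[x [xN cx xx0]]] := x0P i.
    have : S p0 * lam x0 i <= K * (K / N%:R).
      by apply: ler_pM => //; rewrite ler_pM2r ?invr_gt0 // ler_nat.
    have /andP[? _] := phi01 i p0.
    have : 0 <= (1 + K) * (K / N%:R * B) by rewrite mulr_ge0 //; lra.
    lra.
  have close k : `|lam x k - lam x0 k| <= K / N%:R.
    by have [? ?] := xx0 k; exact: lam_close.
  have pp0 : `|p x - p0| <= K / N%:R * B.
    rewrite /p0 /p -sumrB; apply: le_trans (ler_norm_sum _ _ _) _.
    rewrite mulr_sumr; apply: ler_sum => k _.
    by rewrite -scalerBl normrZ ler_wpM2r.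
  have lam1 : lam x i <= 1.
    by rewrite -(sumlam x xN) (bigD1 i) //= lerDl sumr_ge0.
  have h1 : S p0 * lam x0 i <= S p0 * lam x i + K * (K / N%:R).
    have : S p0 * (lam x0 i - lam x i) <= K * (K / N%:R).
      apply: le_trans (_ : S p0 * (K / N%:R) <= _); last by rewrite ler_wpM2r.
      rewrite ler_wpM2l //; apply: le_trans (ler_norm _) _.
      by rewrite distrC.
    lra.
  have h2 : S p0 * lam x i <= S (p x) * lam x i + K * (K / N%:R * B).
    have := Slip p0 (p x); rewrite distrC => h.
    have hS : S p0 - S (p x) <= K * (K / N%:R * B).
      have : K * `|p x - p0| <= K * (K / N%:R * B) by rewrite ler_wpM2l //; lra.
      lra.
    have : (S p0 - S (p x)) * lam x i <= K * (K / N%:R * B).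
      apply: le_trans (_ : K * (K / N%:R * B) * lam x i <= _).
        by rewrite ler_wpM2r.
      by rewrite ler_piMr // mulr_ge0 //; lra.
    lra.
  have h3 : phi i (p x) <= phi i p0 + K / N%:R * B.
    have := le_trans (phi_lip i (p x) p0) pp0.
    by move/(le_trans (ler_norm _)); lra.
  have := cP x xN; rewrite cx; lra.
pose d i := phi i p0 - S p0 * lam x0 i.
have sumd : \sum_i d i = 0.
  by rewrite sumrB -mulr_sumr sumlam // mulr1 subrr.
have absd i : `|d i| <= K * (D / N%:R).
  have DN0 : 0 <= D / N%:R by rewrite divr_ge0.
  rewrite ler_norml; apply/andP; split.
    apply: le_trans (dP i); rewrite lerN2 ler_peMl //.
  have : d i + D / N%:R <= \sum_j (d j + D / N%:R).
    rewrite (bigD1 i) //= lerDl sumr_ge0 // => j _.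
    by have := dP j; rewrite -/(d j); lra.
  by rewrite big_split /= sumd sumr_const add0r -mulr_natl -/K; lra.
have -> : \sum_i phi i p0 *: (y i - p0) = \sum_i d i *: y i.
  under eq_bigr do rewrite scalerBr.
  rewrite sumrB -scaler_suml -/(S p0) /p0 {3}/p scaler_sumr -sumrB.
  by apply: eq_bigr => i _; rewrite scalerA -scalerBl.
apply: le_trans (ler_norm_sum _ _ _) _.
apply: le_trans (_ : K * (D / N%:R) * B <= _).
  by rewrite mulr_sumr; apply: ler_sum => i _; rewrite normrZ ler_wpM2r.
have -> : K * (D / N%:R) * B = K * D * B / N%:R by ring.
by rewrite ler_pdivrMr // [e * _]mulrC -ler_pdivrMr.
Qed.

(** * Compactness in finite dimension *)

Lemma finite_dimensional_basis (R : realType) (X : normedModType R) :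
  finite_dimensional X -> exists (n : nat) (e : 'I_n -> X),
    (forall x, exists c : 'I_n -> R, x = \sum_i c i *: e i) /\
    (forall c : 'I_n -> R, \sum_i c i *: e i = 0 -> forall i, c i = 0).
Proof.
move=> fdX.
pose spans n := `[< exists e : 'I_n -> X,
  forall x, exists c : 'I_n -> R, x = \sum_i c i *: e i >].
have ex_spans : exists n, spans n.
  by have [n [e espan]] := fdX; exists n; apply/asboolP; exists e.
(* A spanning family of least length is free: a relation with [c k != 0] would eliminate [e k]. *)
case: (ex_minnP ex_spans) => n /asboolP[e espan] nmin; exists n, e; split => // c c0 k.
apply: contrapT => /eqP ck0; case: n e espan nmin c c0 k ck0 => [|n] e espan nmin c c0 k ck0.
  by case: k ck0.
suff /nmin : spans n by rewrite ltnn.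
apply/asboolP; exists (e \o lift k) => x; have [a ->] := espan x.
exists (fun i => a (lift k i) - a k * (c k)^-1 * c (lift k i)).
rewrite (bigD1_ord k) //=.
under [RHS]eq_bigr do rewrite scalerBl -scalerA.
rewrite sumrB -scaler_sumr addrC; congr (_ + _).
move: c0; rewrite (bigD1_ord k) //= => /eqP; rewrite addrC addr_eq0 => /eqP ->.
by rewrite scalerN opprK scalerA divfK.
Qed.

(** Since the basis is free, [|L v|] has a positive minimum on the unit sphere of the coordinate
    space. So [L] pulls bounded sets back to bounded sets, and [A] is the continuous image of a
    closed bounded set of row vectors. *)
Lemma finite_dimensional_compact (R : realType) (X : normedModType R) (A : set X) :
  finite_dimensional X -> bounded_set A -> closed A -> compact A.
Proof.
move=> /finite_dimensional_basis[n [e [espan efree]]] bA clA.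
pose L (v : 'rV[R]_n) : X := \sum_i v ord0 i *: e i.
have LZ a v : L (a *: v) = a *: L v.
  by rewrite /L scaler_sumr; apply: eq_bigr => i _; rewrite mxE scalerA.
have Lcont : continuous L.
  suff key (s : seq 'I_n) : continuous (fun v : 'rV[R]_n => \sum_(i <- s) v ord0 i *: e i).
    exact: key.
  elim: s => [|i s IH].
    rewrite (_ : (fun _ => _) = cst 0); first exact: cst_continuous.
    by apply/funext => v; rewrite big_nil.
  rewrite (_ : (fun _ => _) =
      fun v : 'rV[R]_n => v ord0 i *: e i + \sum_(i <- s) v ord0 i *: e i); last first.
    by apply/funext => v; rewrite big_cons.
  move=> v; apply: cvgD; [exact: nbhs_filter | | exact: IH].
  exact: (@cvgZr_tmp R X 'rV[R]_n (nbhs v) _ (fun w => w ord0 i) (v ord0 i) (e i)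
    (@coord_continuous R 1 n ord0 i v)).
have [a a0 La] : exists2 a : R, 0 < a & forall v, a * `|v| <= `|L v|.
  pose Sph : set 'rV[R]_n := [set v | `|v| = 1].
  have nrm (v : 'rV[R]_n) : v != 0 -> Sph (`|v|^-1 *: v).
    move=> v0; rewrite /Sph /= normrZ normfV normr_id mulVf //.
    by rewrite normr_eq0.
  (* An empty sphere means that [0] is the only vector, and then any [a] works. *)
  have [S0|S0] := pselect (Sph !=set0); last first.
    exists 1 => // v; have [->|v0] := eqVneq v 0; first by rewrite normr0 mulr0.
    by exfalso; apply: S0; exists (`|v|^-1 *: v); exact: nrm.
  have cS : compact Sph.
    apply: bounded_closed_compact.
      by exists 1; split => // M M1 v /= ->; exact: ltW.
    apply: (@closed_comp _ _ (fun v : 'rV[R]_n => `|v|) [set 1]) => [v _|].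
      exact: norm_continuous.
    exact: closed_eq.
  have [|v0 v0S vmin] := @compact_EVT_min _ R (fun v => `|L v|) _ S0 cS.
    apply: continuous_subspaceT => v; apply: cvg_comp; first exact: Lcont.
    exact: norm_continuous.
  exists `|L v0|.
    rewrite normr_gt0; apply/eqP => L0.
    have v00 : v0 = 0 by apply/rowP => i; rewrite mxE; exact: (efree (v0 ord0)).
    move: v0S; rewrite inE /Sph /= v00 normr0 => /esym/eqP.
    by rewrite oner_eq0.
  move=> v; have [->|v0'] := eqVneq v 0; first by rewrite normr0 mulr0.
  have := vmin (`|v|^-1 *: v); rewrite inE => /(_ (nrm v v0')).
  by rewrite LZ normrZ normfV normr_id ler_pdivlMl ?normr_gt0 // mulrC.
have -> : A = L @` (L @^-1` A).
  apply/seteqP; split => [x Ax|x [v Av <-]//].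
  have [c xc] := espan x; exists (\row_i c i).
    by rewrite /= /L; under eq_bigr do rewrite mxE; rewrite -xc.
  by rewrite /L xc; apply: eq_bigr => i _; rewrite mxE.
apply: continuous_compact; first exact: continuous_subspaceT.
apply: bounded_closed_compact; last by apply: closed_comp => // v _; exact: Lcont.
have [M [Mr AM]] := bA.
exists (a^-1 * (`|M| + 1)); split; first exact: num_real.
move=> K MK v /= Av; apply: le_trans (ltW MK).
rewrite ler_pdivlMl //; apply: le_trans (La v) _.
apply: (AM (`|M| + 1)) => //; have := ler_norm M; lra.
Qed.

(** * Convex combinations and lower semicontinuous maps *)

Lemma convex_set_segment (R : realType) (X : lmodType R) (A : set X) (x y : X) (t : R) :
  convex_set A -> A x -> A y -> 0 <= t -> t <= 1 -> A (t *: x + (1 - t) *: y).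
Proof.
move=> cA Ax Ay t0 t1.
by have := cA x y (Itv01 t0 t1); rewrite !inE => /(_ Ax Ay).
Qed.

(** By induction each partial sum is its total weight times a point of [A]; a zero total weight
    leaves that point arbitrary. *)
Lemma convex_set_sum (R : realType) (X : lmodType R) (I : finType) (A : set X)
    (lam : I -> R) (u : I -> X) :
  convex_set A -> (forall i, 0 <= lam i) -> \sum_i lam i = 1 ->
  (forall i, A (u i)) -> A (\sum_i lam i *: u i).
Proof.
move=> cA lam0 lam1 Au.
suff key : forall s : seq I, let t := \sum_(i <- s) lam i in
    0 <= t /\ exists2 z, A z & \sum_(i <- s) lam i *: u i = t *: z.
  by have [_ [z Az ->]] := key (index_enum I); rewrite lam1 scale1r.
elim=> [|i s [t0 [z Az sz]]] /=.
  have [i _|I0] := pickP (fun _ : I => true).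
    by split; rewrite ?big_nil //; exists (u i); rewrite ?scale0r.
  by move: lam1; rewrite big1 => [/esym/eqP|i _]; [rewrite oner_eq0 | have := I0 i].
move: t0 sz; rewrite !big_cons; move: (\sum_(_ <- _) lam _) => t t0 ->.
have lit0 : 0 <= lam i + t by rewrite addr_ge0.
split => //; have [lt0|ltn0] := eqVneq (lam i + t) 0.
  have li : lam i = 0 by have := lam0 i; lra.
  have ti : t = 0 by lra.
  by exists z; rewrite // li ti !scale0r !addr0 scale0r.
exists ((lam i / (lam i + t)) *: u i + (1 - lam i / (lam i + t)) *: z).
  apply: convex_set_segment => //; first by rewrite divr_ge0.
  by rewrite ler_pdivrMr ?lt_neqAle ?lit0 ?[0 == _]eq_sym ?ltn0 // mul1r lerDl.
rewrite scalerDr !scalerA; congr (_ *: _ + _ *: _); first by rewrite mulrC divfK.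
by rewrite mulrBr mulr1 [X in _ = _ - X]mulrC divfK // addrC addKr.
Qed.

(** Near each [x] the values of [F] come within [d] of one fixed [y x]. A finite subcover with tent
    functions [phi i] gives a point [p] almost fixed by the combination of the [y x]. Replacing
    these by nearby points of the convex set [F p] costs at most [d] more. *)
Lemma lsc_approximate_fixed_point (R : realType) (X : normedModType R) (C : set X)
    (F : X -> set X) (e : R) :
  C !=set0 -> compact C -> convex_set C -> 0 < e ->
  lower_semicontinuous_in C F ->
  (forall x, C x -> [/\ F x !=set0, F x `<=` C & convex_set (F x)]) ->
  exists x y, [/\ C x, F x y & `|x - y| < e].
Proof.
move=> [x0 Cx0] cC cvC e0 lscF FP.
(* Two errors of at most [d] each arise below, so the bound [e] is strict. *)
pose d := e / 4; have d0 : 0 < d by rewrite divr_gt0.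
have /choice[yr yrP] (x : X) : exists yr : X * R, C x ->
    [/\ C yr.1, 0 < yr.2, yr.2 <= 1 & forall z, C z -> `|x - z| < yr.2 ->
      exists2 u, F z u & `|u - yr.1| < d].
  have [Cx|] := pselect (C x); last by exists (x, 0).
  have [[y Fxy] FC _] := FP x Cx.
  have [|||U [[U' oU' UE] Ux UF]] := lscF x (C `&` ball y d) => //.
  - by exists (ball y d); first exact: ball_open.
  - by exists y; split => //; split; [exact: FC | exact: ballxx].
  have : nbhs x U' by apply: open_nbhs_nbhs; split => //; move: Ux; rewrite UE => -[].
  case/nbhs_ballP => r /= r0 rU'.
  (* Capping the radius at [1] keeps the tent functions below [1]. *)
  exists (y, Num.min r 1) => _ /=; split; first exact: FC.
  - by rewrite lt_min r0 ltr01.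
  - by rewrite ge_min lexx orbT.
  move=> z Cz; rewrite lt_min => /andP[xzr _].
  have [|u [Fzu [_ yu]]] := UF z.
    by rewrite UE; split => //; apply: rU'; rewrite -ball_normE.
  by exists u => //; move: yu; rewrite -ball_normE /= distrC.
pose y x := (yr x).1; pose r x := (yr x).2.
have : cover_compact C by rewrite -compact_cover.
move=> /(_ _ C (fun x => ball x (r x / 2)))[||D DC Dcov].
- by move=> x _; exact: ball_open.
- move=> x Cx; exists x => //; apply: ballxx.
  by have [_ ? _ _] := yrP x Cx; rewrite divr_gt0.
have DP (i : D) : C (val i) by have := DC _ (valP i); rewrite inE.
pose phi (i : D) z := Num.max 0 (r (val i) - `|val i - z|).
have phi01 i z : 0 <= phi i z <= 1.
  rewrite /phi le_max lexx /= ge_max ler01 /=.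
  have [_ _ r1 _] := yrP _ (DP i); have := normr_ge0 (val i - z).
  by rewrite -/(r _) in r1; lra.
have phi_lip i z z' : `|phi i z - phi i z'| <= `|z - z'|.
  suff lip z1 z2 : phi i z1 <= phi i z2 + `|z1 - z2|.
    by rewrite ler_distl lip lerBlDr distrC lip.
  rewrite /phi ge_max addr_ge0 ?le_max ?lexx //=.
  have : `|val i - z2| <= `|val i - z1| + `|z1 - z2| by exact: ler_distD.
  have : r (val i) - `|val i - z2| <= Num.max 0 (r (val i) - `|val i - z2|).
    by rewrite le_max lexx orbT.
  lra.
(* Balls of half the radius already cover [C], so the tents sum to at least [rho] everywhere on [C].
   The tolerance [rho * d] thus becomes at most [d] after division by [S]. *)
pose rho := \big[Num.min/1]_(i : D) (r (val i) / 2).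
have rho0 : 0 < rho.
  apply: lt_bigmin => // i _; have [_ ? _ _] := yrP _ (DP i).
  by rewrite divr_gt0.
have D_gt0 : (0 < #|{: D}|)%N.
  by have [i Di _] := Dcov _ Cx0; apply/card_gt0P; exists [` Di]%fset.
have rhod : 0 < rho * d by rewrite mulr_gt0.
have [lam [lam0 lam1]] := approximate_brouwer (fun i : D => y (val i)) D_gt0 rhod phi01 phi_lip.
set p := \sum_j lam j *: _ => hp.
have Cp : C p.
  by apply: convex_set_sum => // i; have [] := yrP _ (DP i).
pose S := \sum_i phi i p.
have Srho : rho <= S.
  have [i Di] := Dcov _ Cp; rewrite -ball_normE /= => ip.
  have : rho <= r (val [` Di]%fset) / 2 by exact: bigmin_le_cond.
  rewrite /S (bigD1 [` Di]%fset) //= => h.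
  have h2 : r i / 2 <= phi [` Di]%fset p by rewrite /phi /= le_max; apply/orP; right; lra.
  have : 0 <= \sum_(j | j != [` Di]%fset) phi j p.
    by apply: sumr_ge0 => j _; case/andP: (phi01 j p).
  lra.
have S0 : 0 < S by exact: lt_le_trans Srho.
have [[v Fpv] _ cFp] := FP p Cp.
(* Outside the ball of index [i] the weight [phi i p] vanishes, so any point [v] of [F p] serves. *)
have /choice[u uP] (i : D) : exists u, F p u /\ phi i p * `|u - y (val i)| <= phi i p * d.
  have [_ _ _ h] := yrP _ (DP i).
  have [ip|ip] := ltP `|val i - p| (r (val i)).
    have [u Fu ud] := h p Cp ip; exists u; split => //.
    by rewrite ler_wpM2l ?(ltW ud) //; case/andP: (phi01 i p).
  exists v; split => //; suff -> : phi i p = 0 by rewrite !mul0r.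
  by rewrite /phi max_l // subr_le0.
pose mu i := phi i p / S.
have mu0 i : 0 <= mu i by rewrite divr_ge0 ?(ltW S0) //; case/andP: (phi01 i p).
have mu1 : \sum_i mu i = 1 by rewrite -mulr_suml divff // gt_eqF.
exists p, (\sum_i mu i *: u i); split => //.
  by apply: convex_set_sum => // i; have [] := uP i.
have -> : p - \sum_i mu i *: u i =
    - (S^-1 *: (\sum_i phi i p *: (y (val i) - p) + \sum_i phi i p *: (u i - y (val i)))).
  rewrite -big_split /= -[in LHS](scale1r p) -mu1 scaler_suml -sumrB scaler_sumr -sumrN.
  apply: eq_bigr => i _; rewrite -scalerDr scalerA -scalerBr mulrC -/(mu i).
  by rewrite -scalerN addrCA addrAC subrr add0r opprB.
rewrite normrN normrZ normfV gtr0_norm // ltr_pdivrMl //.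
apply: le_lt_trans (ler_normD _ _) _.
have h2 : `|\sum_i phi i p *: (u i - y (val i))| <= S * d.
  apply: le_trans (ler_norm_sum _ _ _) _; rewrite mulr_suml; apply: ler_sum => i _.
  by rewrite normrZ ger0_norm ?(uP i).2 //; case/andP: (phi01 i p).
have h3 : rho * d <= S * d by rewrite ler_wpM2r // ltW.
have h4 : 0 < S * d by rewrite mulr_gt0.
have -> : S * e = 4 * (S * d) by rewrite /d; field.
lra.
Qed.

(** * Measurable selection *)

Lemma countable_enum (T : Type) (A : set T) :
  countable A -> A !=set0 -> exists f : nat -> T, range f = A.
Proof.
move=> /pfcard_geP[-> [x []]|[f] _]; exists f.
apply/seteqP; split => [_ [n _ <-]|x Ax]; first exact: funS.
by have [n _ <-] := @surj _ _ _ _ f x Ax; exists n.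
Qed.

Section measurable_selection.
Context d (Omega : measurableType d) (R : realType).

(** Choosing the least index makes the fibre over [k] equal to [P k] minus the finitely many earlier
    [P j]. *)
Lemma measurable_least_index (P : nat -> set Omega) :
  (forall k, measurable (P k)) -> (forall w, exists k, P k w) ->
  exists s : Omega -> nat,
    (forall w, P (s w) w) /\ (forall k, measurable (s @^-1` [set k])).
Proof.
move=> mP exP.
have /choice[s sP] (w : Omega) : exists k, P k w /\ forall j, (j < k)%N -> ~ P j w.
  have ex : exists k, `[< P k w >] by have [k Pk] := exP w; exists k; apply/asboolP.
  case: (ex_minnP ex) => k /asboolP Pk kmin; exists k; split => // j jk Pj.
  by have := kmin j; rewrite leqNgt jk => /(_ (asboolT Pj)).
exists s; split => [w|k]; first by have [] := sP w.
have -> : s @^-1` [set k] = P k `&` \bigcap_(j in [set j | (j < k)%N]) ~` P j.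
  apply/seteqP; split => w /=.
    by move=> <-; have [Ps nP] := sP w; split => // j jk; exact: nP.
  move=> [Pk nP]; have [Ps nPs] := sP w; apply/eqP; rewrite eqn_leq.
  apply/andP; split; rewrite leqNgt; apply/negP => lt; first exact: (nPs k).
  exact: (nP _ lt).
by apply: measurableI => //; apply: bigcap_measurableType => j _; exact: measurableC.
Qed.

Lemma measurable_fiberwise (s : Omega -> nat) (Q : nat -> set Omega) :
  (forall k, measurable (s @^-1` [set k])) -> (forall k, measurable (Q k)) ->
  measurable [set w | Q (s w) w].
Proof.
move=> ms mQ; have -> : [set w | Q (s w) w] = \bigcup_k (s @^-1` [set k] `&` Q k).
  by apply/seteqP; split => w /= => [Qw|[k _ [<- //]]]; exists (s w).
by apply: bigcupT_measurable => k; apply: measurableI.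
Qed.

(* The successive approximations of the Kuratowski--Ryll-Nardzewski theorem,
   started at a prescribed countably-valued map so that the selection stays
   near it. *)
Lemma measurable_selection_near (X : completeNormedModType R)
    (F : Omega -> set X) (D : nat -> X) (s0 : Omega -> nat) (r : R) :
  0 < r ->
  (forall w, closed (F w)) ->
  (forall w, F w `<=` closure (range D)) ->
  (forall V, open V -> measurable [set w | F w `&` V !=set0]) ->
  (forall k, measurable (s0 @^-1` [set k])) ->
  (forall w, F w `&` ball (D (s0 w)) r !=set0) ->
  exists f : Omega -> X,
    [/\ measurable_fun [set: Omega] (f : Omega -> g_sigma_algebraType (@open X)),
        forall w, F w (f w) & forall w, `|D (s0 w) - f w| <= 3 * r].
Proof.
move=> r0 clF FD mF ms0 s0P.
pose ok (r : R) (s : Omega -> nat) :=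
  (forall k, measurable (s @^-1` [set k])) /\
  (forall w, F w `&` ball (D (s w)) r !=set0).
have /choice[nxt nxtP] (a : R * (Omega -> nat)) : exists s' : Omega -> nat,
    0 < a.1 -> ok a.1 a.2 ->
    ok (a.1 / 2) s' /\ forall w, `|D (a.2 w) - D (s' w)| <= a.1 + a.1 / 2.
  case: a => t s /=; have [t0|?] := ltP 0 t; last by exists s.
  have [[ms sP]|?] := pselect (ok t s); last by exists s.

  (* The next centre must have [F w] meet both its ball of half the radius and the current ball in a
     common point, which keeps successive centres close. *)
  have [||s' [s'P ms']] := @measurable_least_index (fun j =>
    [set w | F w `&` (ball (D (s w)) t `&` ball (D j) (t / 2)) !=set0]).
  - move=> j; apply: (@measurable_fiberwise s (fun i =>
      [set w | F w `&` (ball (D i) t `&` ball (D j) (t / 2)) !=set0])) => // i.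
    by apply: mF; apply: openI; exact: ball_open.
  - move=> w; have [z [Fz sz]] := sP w.
    have [|_ [[j _ <-]]] := FD w z Fz (ball z (t / 2)).
      by apply: nbhsx_ballx; rewrite divr_gt0.
    by move=> /ball_sym zj; exists j, z.
  exists s' => _ _; split; first split => //.
    by move=> w; have [z [Fz [_ ?]]] := s'P w; exists z.
  move=> w; have [z [_ []]] := s'P w; rewrite -!ball_normE /= => h1 h2.
  have := ler_distD z (D (s w)) (D (s' w)); rewrite (distrC z); lra.
pose t n : R := r / 2 ^+ n.
have t0 n : 0 < t n by rewrite divr_gt0 // exprn_gt0.
have tS n : t n / 2 = t n.+1 by rewrite /t exprSr invfM mulrA.
pose s := fix s n := if n is n'.+1 then nxt (t n', s n') else s0.
have sok n : ok (t n) (s n).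
  elim: n => [|n IH]; first by rewrite /t expr0 divr1.
  by have [+ _] := nxtP (t n, s n) (t0 n) IH; rewrite tS.
pose u w n := D (s n w).
have uS w n : `|u w n - u w n.+1| <= t n + t n.+1.
  by have [_ /(_ w)] := nxtP (t n, s n) (t0 n) (sok n); rewrite tS.
(* As [t n = 2 * t n.+1], each step [t n + t n.+1] equals [3 * (t n - t n.+1)], and the bounds
   telescope. *)
have uD w n k : `|u w n - u w (n + k)%N| <= 3 * t n - 3 * t (n + k)%N.
  elim: k => [|k IH]; first by rewrite addn0 !subrr normr0.
  rewrite addnS; have := ler_distD (u w (n + k)%N) (u w n) (u w (n + k).+1).
  by have := uS w (n + k)%N; have := tS (n + k)%N; lra.
have uM w n m : (n <= m)%N -> `|u w n - u w m| <= 3 * t n.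
  move=> nm; have := uD w n (m - n)%N; rewrite subnKC // => h.
  by have := t0 m; lra.
(* The factor [4] adds the distance [3 * t n] from the centre to the limit and [t n] from the centre
   to [F w]. *)
have small (e : R) : 0 < e -> exists n, 4 * t n < e.
  move=> e0; have A0 : 0 <= 4 * r / e by rewrite divr_ge0 ?(ltW e0) // mulr_ge0 // ltW.
  exists (Num.bound (4 * r / e)); set n := Num.bound _.
  have : 4 * r / e < 2 ^+ n.
    apply: lt_trans (archi_boundP A0) _; rewrite -/n -natrX ltr_nat.
    exact: ltn_expl.
  by rewrite ltr_pdivrMr // /t mulrA ltr_pdivrMr ?exprn_gt0 // [e * _]mulrC.
have /choice[f fP] (w : Omega) : exists l : X, u w @ \oo --> l.
  suff cu : cvg (u w @ \oo) by exists (lim (u w @ \oo)).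
  apply/cauchy_cvgP; apply: cauchy_exP => e e0.
  have [n tn] := small e e0; exists (u w n); exists n => // m /= nm.
  rewrite -ball_normE /=; apply: le_lt_trans (uM w n m nm) _.
  by have := t0 n; lra.
have fu w n : `|u w n - f w| <= 3 * t n.
  apply/ler_addgt0Pr => e e0.
  have /cvgrPdist_le/(_ e e0)[N _ hN] := fP w.
  have := hN (maxn N n) (leq_maxl _ _); have := uM w n _ (leq_maxr N n).
  have := ler_distD (u w (maxn N n)) (u w n) (f w).
  by rewrite (distrC (u w (maxn N n)) (f w)); lra.
exists f; split; last by move=> w; have := fu w 0%N; rewrite /t expr0 divr1.
- apply: (@measurability _ _ Omega (g_sigma_algebraType (@open X)) setT f
    (@open X) erefl) => _ [U oU <-]; rewrite setTI.
  (* The limit lies in the closed ball of radius [3 * t n] about its [n]-th centre, so membership in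
     [U] is detected by countably many centres whose ball is inside [U]. *)
  have -> : f @^-1` U = \bigcup_n \bigcup_(k in [set k |
      forall z, `|D k - z| <= 3 * t n -> U z]) (s n @^-1` [set k]).
    apply/seteqP; split => w; last by move=> [n _ [k hk /= sk]]; apply: hk; rewrite -sk; exact: fu.
    move=> /= Uf; have : nbhs (f w) U by exact: open_nbhs_nbhs.
    case/nbhs_ballP => e /= e0 eU.
    have e20 : 0 < e / 2 by rewrite divr_gt0.
    have [n tn] := small _ e20.
    exists n => //; exists (s n w) => //= z zn; apply: eU; rewrite -ball_normE /=.
    have := ler_distD (D (s n w)) (f w) z; have := fu w n; rewrite /u.
    by rewrite (distrC (f w) (D _)); have := t0 n; lra.
  apply: bigcupT_measurable => n; apply: bigcup_measurable => k _.
  by have [+ _] := sok n; apply.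
move=> w; rewrite (closure_id (F w)).1 //= => A /nbhs_ballP[e /= e0 eA].
have [n tn] := small e e0.
have [_ /(_ w)[z [Fz]]] := sok n; rewrite -ball_normE /= => zn.
exists z; split => //; apply: eA; rewrite -ball_normE /=.
have := ler_distD (D (s n w)) (f w) z; have := fu w n; rewrite /u.
by rewrite (distrC (f w) (D _)); lra.
Qed.

End measurable_selection.

(** * Construction of the random fixed point *)

Theorem corollary4 (d : measure_display) (Omega : measurableType d)
  (R : realType) (X : completeNormedModType R) (C : set X)
  (T : Omega -> X -> set X) :
  finite_dimensional X ->
  C !=set0 -> closed C -> convex_set C -> bounded_set C -> separable_set C ->
  random_operator C T ->
  condition_M C T ->
  (forall w, lower_semicontinuous_in C (T w)) ->
  (forall w, one_set_contractive C (T w)) ->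
  (forall w x, C x ->
    [/\ T w x !=set0, convex_set (T w x) & closed (T w x)]) ->
  (forall w y, C y -> closed (C `&` [set x | T w x y])) ->
  exists xi : Omega -> X, random_fixed_point C T xi.
Proof.
move=> fdX C0 clC cvC bC [E [cE EC Edense]] [TC mT] hM lscT _ TP _.
have cC : compact C by exact: finite_dimensional_compact.
have E0 : E !=set0.
  have [x Cx] := C0; have [|y [Ey _]] := Edense x Cx setT; first exact: filterT.
  by exists y.
have [D rD] := countable_enum cE E0.
have CD k : C (D k) by apply: EC; rewrite -rD; exists k.
have mTD k V : open V -> measurable [set w | T w (D k) `&` V !=set0].
  move=> oV; have := mT (D k) (CD k) (C `&` V) (ex_intro2 _ _ V oV erefl).
  congr measurable; apply/funext => w; apply/propext; split => -[z [Tz]].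
    by move=> [_ Vz]; exists z.
  by move=> Vz; exists z; do 2 split => //; exact: (TC w _ (CD k)).2.
pose r n : R := n.+1%:R^-1.
have r0 n : 0 < r n by rewrite invr_gt0.
have near_fixed w n : exists k, T w (D k) `&` ball (D k) (r n) !=set0.
  (* The radius is split in three: from [x] to its approximate image [y], from [x] to a dense point
     [D k], and from [y] to a point [z] of [T w (D k)] given by lower semicontinuity. *)
  have r3 : 0 < r n / 3 by rewrite divr_gt0.
  have [|x [y [Cx Txy xy]]] := lsc_approximate_fixed_point C0 cC cvC r3 (lscT w).
    by move=> x Cx; have [? ? _] := TP w x Cx; have [_ ?] := TC w x Cx.
  have [||U [[U' oU' UE] Ux UT]] := lscT w x (C `&` ball y (r n / 3)) Cx.
  - by exists (ball y (r n / 3)) => //; exact: ball_open.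
  - by exists y; split => //; split; [exact: (TC w x Cx).2 | exact: ballxx].
  have [_ [[k _ <-] [U'k xk]]] : range D `&` (U' `&` ball x (r n / 3)) !=set0.
    rewrite rD; apply: (Edense x Cx); apply: filterI; last exact: nbhsx_ballx.
    by apply: open_nbhs_nbhs; split => //; move: Ux; rewrite UE => -[].
  have [|z [Tz [_ yz]]] := UT (D k); first by rewrite UE.
  exists k, z; split => //; move: xk yz; rewrite -!ball_normE /= => xk yz.
  have := ler_distD x (D k) z; have := ler_distD y x z.
  by rewrite (distrC (D k) x); lra.
have /choice[s sP] n : exists s : Omega -> nat,
    (forall w, T w (D (s w)) `&` ball (D (s w)) (r n) !=set0) /\
    (forall k, measurable (s @^-1` [set k])).
  apply: (measurable_least_index (P := fun k =>
    [set w | T w (D k) `&` ball (D k) (r n) !=set0])) => [k|w].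
    by apply: mTD; exact: ball_open.
  exact: near_fixed.
have /choice[eta etaP] n : exists eta : Omega -> X,
    [/\ measurable_fun [set: Omega] (eta : Omega -> g_sigma_algebraType (@open X)),
        forall w, T w (D (s n w)) (eta w) &
        forall w, `|D (s n w) - eta w| <= 3 * r n].
  have [sn ms] := sP n.
  apply: (measurable_selection_near (F := fun w => T w (D (s n w)))) => //.
  - by move=> w; have [] := TP w _ (CD (s n w)).
  - by move=> w z Tz; rewrite rD; apply: Edense; exact: (TC w _ (CD (s n w))).2 _ Tz.
  - move=> V oV; apply: (measurable_fiberwise (Q := fun k =>
      [set w | T w (D k) `&` V !=set0])) => // k.
    exact: mTD.
apply: (hM eta (fun n w => D (s n w))) => [n|n|n w|w].
- have [meta Teta _] := etaP n; split => // w.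
  exact: (TC w _ (CD (s n w))).2 _ (Teta w).
- split => [w|]; first exact: CD.
  (* The map takes countably many values on measurable fibres, so preimages of arbitrary sets are
     measurable. *)
  move=> _ Y _; rewrite setTI.
  apply: (measurable_fiberwise (Q := fun k => [set w | Y (D k)])) => [|k]; first exact: (sP n).2.
  have [Yk|Yk] := pselect (Y (D k)).
    by rewrite (_ : [set _ | _] = setT) //; apply/seteqP; split.
  by rewrite (_ : [set _ | _] = set0) //; apply/seteqP; split.
- by have [_ ? _] := etaP n.
apply/cvgrPdist_le => e e0.
have A0 : 0 <= 3 / e by rewrite divr_ge0 // ltW.
exists (Num.bound (3 / e)) => // n /= bn; rewrite sub0r normrN.
have [_ _ /(_ w) h] := etaP n; apply: le_trans h _.
rewrite /r ler_pdivrMr // -ler_pdivrMl // mulrC.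
apply: le_trans (ltW (archi_boundP A0)) _.
by rewrite ler_nat ltnW.
Qed.
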